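(* Let $J$ be an $m\times m$ matrix with $J=J^*=J^{-1}$, and let $H(\xi,\eta)=H(\xi,\eta)^*$ and $\mathcal{H}(\xi,\eta)=\mathcal{H}(\xi,\eta)^*$ be $m\times m$ complex matrix functions satisfying $$JH-J\mathcal{H}+\mathrm{i}\,[JH,J\mathcal{H}]=0,\qquad H_{\eta}=\mathcal{H}_{\xi}.$$ Let $\mathcal{A}$, $S(0,0)=S(0,0)^*$ be $n\times n$ complex matrices and $\Pi(0,0)$ an $n\times m$ complex matrix such that $$\mathcal{A}S(0,0)-S(0,0)\mathcal{A}^*=\mathrm{i}\,\Pi(0,0)J\Pi(0,0)^*.$$ Set $A(\xi,\eta)=\big(\mathcal{A}-(\xi+\eta)I_n\big)^{-1}$ and let $\Pi(\xi,\eta)$, $S(\xi,\eta)$ be determined by the values $\Pi(0,0)$, $S(0,0)$ and by the equations $$\Pi_{\xi}=-\mathrm{i}A\Pi JH,\qquad \Pi_{\eta}=-\mathrm{i}A\Pi J\mathcal{H},$$ $$S_{\xi}=\Pi JHJ^*\Pi^*-(AS+SA^* ),\qquad S_{\eta}=\Pi J\mathcal{H}J^*\Pi^*-(AS+SA^* ).$$ Let $w_A(\xi,\eta,\lambda)=I_m-\mathrm{i}J\Pi(\xi,\eta)^*S(\xi,\eta)^{-1}\big(A(\xi,\eta)-\lambda I_n\big)^{-1}\Pi(\xi,\eta)$, let the $m\times m$ matrix function $w_0(\xi,\eta)$ satisfy $$\frac{\partial w_0}{\partial\xi}=\widetilde{G}_0w_0,\qquad \frac{\partial w_0}{\partial\eta}=\widetilde{F}_0w_0,\qquad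 w_0(0,0)^*Jw_0(0,0)=J,$$ $$\widetilde{G}_0=-\mathrm{i}J\Pi^*S^{-1}\Pi-[J\Pi^*S^{-1}\Pi,JH],\qquad \widetilde{F}_0=-\mathrm{i}J\Pi^*S^{-1}\Pi-[J\Pi^*S^{-1}\Pi,J\mathcal{H}],$$ and set $$v(\xi,\eta,z):=w_0(\xi,\eta)^{-1}w_A\big(\xi,\eta,(z-\xi-\eta)^{-1}\big).$$ Then $v$ satisfies the systems $$v_{\xi}(\xi,\eta,z)=\mathrm{i}(z-\xi-\eta)^{-1}\big(J\widetilde{H}(\xi,\eta)v(\xi,\eta,z)-v(\xi,\eta,z)JH(\xi,\eta)\big),$$ $$v_{\eta}(\xi,\eta,z)=\mathrm{i}(z-\xi-\eta)^{-1}\big(J\widetilde{\mathcal{H}}(\xi,\eta)v(\xi,\eta,z)-v(\xi,\eta,z)J\mathcal{H}(\xi,\eta)\big),$$ where $$\widetilde{H}(\xi,\eta)=w_0(\xi,\eta)^*H(\xi,\eta)w_0(\xi,\eta),\qquad \widetilde{\mathcal{H}}(\xi,\eta)=w_0(\xi,\eta)^*\mathcal{H}(\xi,\eta)w_0(\xi,\eta).$$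
   Context: Here $m,n\in\mathbb{N}$, $\mathrm{i}$ is the imaginary unit, $I_k$ is the $k\times k$ identity matrix, $M^*$ is the conjugate transpose of $M$, $[X,Y]=XY-YX$, and subscripts $\xi,\eta$ denote partial derivatives. The real variables $(\xi,\eta)$ range over a connected open set (e.g. an open rectangle) $D\subset\mathbb{R}^2$ containing $(0,0)$ on which $H,\mathcal{H}$ are continuously differentiable, $\mathcal{A}-(\xi+\eta)I_n$ is invertible, the solutions $\Pi,S,w_0$ exist, and $S(\xi,\eta)$ is invertible. The complex number $z$ is an independent (''hidden'') spectral parameter, and the formulas are considered for $z$ outside the spectrum of $\mathcal{A}$ with $z\neq\xi+\eta$.
   Formalization: The initial identity is taken as A(0,0)S(0,0) − S(0,0)A(0,0)* = iΠ(0,0)JΠ(0,0)* with A(0,0) the inverse of script 𝒜, instead of with 𝒜 itself; with 𝒜 the claim fails (m=n=1, J=1, H=ℋ=0, 𝒜=i, Π=1+i, S=1+(ξ+η)²). *)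

(* Defs.v *)
From HB Require Import structures.
From mathcomp Require Import all_boot all_order all_algebra.
From mathcomp Require Import complex.
From mathcomp Require Import all_classical all_reals all_analysis.

Set Implicit Arguments.
Unset Strict Implicit.
Unset Printing Implicit Defensive.

Import Order.TTheory GRing.Theory Num.Theory.
Import numFieldNormedType.Exports.

Local Open Scope classical_set_scope.
Local Open Scope ring_scope.
Local Open Scope sesquilinear_scope.

(* Calculus of complex matrix functions of a point (xi, eta) of R * R.
   The library has no normed R-module structure on R[i], so derivatives and
   continuity are taken on the real and imaginary parts of every entry. *)
Section PartialDerivatives.
Context {R : realType} {p q : nat}.
Implicit Types (M : R * R -> 'M[R[i]]_(p, q)) (d x : R * R).

Definition mx_derivable (d : R * R) M (x : R * R) : Prop :=
  forall i j, derivable (fun y => complex.Re (M y i j)) x d /\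
              derivable (fun y => complex.Im (M y i j)) x d.

Definition mx_partial (d : R * R) M (x : R * R) : 'M[R[i]]_(p, q) :=
  \matrix_(i, j) Complex ('D_d (fun y => complex.Re (M y i j)) x)
                         ('D_d (fun y => complex.Im (M y i j)) x).

Definition is_mx_partial (d : R * R) M (x : R * R) (M' : 'M[R[i]]_(p, q)) :
  Prop := mx_derivable d M x /\ mx_partial d M x = M'.

Definition mx_continuous_at M (x : R * R) : Prop :=
  forall i j, {for x, continuous (fun y => complex.Re (M y i j))} /\
              {for x, continuous (fun y => complex.Im (M y i j))}.

End PartialDerivatives.

Definition dxi {R : realType} : R * R := (1, 0).
Definition deta {R : realType} : R * R := (0, 1).

Definition mx_C1_on {R : realType} {p q : nat} (D : set (R * R))
    (M : R * R -> 'M[R[i]]_(p, q)) : Prop :=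
  forall d, d = dxi \/ d = deta -> forall x, D x ->
    mx_derivable d M x /\ mx_continuous_at (mx_partial d M) x.

Section Darboux.
Context {R : realType} {m n : nat}.
Local Notation C := R[i].

Definition mx_comm (X Y : 'M[C]_m) : 'M[C]_m := X *m Y - Y *m X.

(* The matrix identity of the Darboux transformation is about this A(x), at
   (0, 0) as elsewhere: the equations for Pi and S preserve
   A S - S A^* = 'i Pi J Pi^*, and the statement is false if the identity at
   (0, 0) is required of calA = A(0, 0)^-1 instead (m = n = 1, J = 1,
   H = calH = 0, calA = 'i, S = 1 + (xi + eta)^2, Pi = 1 + 'i). *)
Definition Amx (calA : 'M[C]_n) (x : R * R) : 'M[C]_n :=
  invmx (calA - (x.1 + x.2)%:C%C%:M).

Definition wA (J : 'M[C]_m) (calA : 'M[C]_n)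
    (Pi : R * R -> 'M[C]_(n, m)) (S : R * R -> 'M[C]_n)
    (x : R * R) (lambda : C) : 'M[C]_m :=
  1%:M - 'i%C *: (J *m (Pi x)^t* *m invmx (S x)
                    *m invmx (Amx calA x - lambda%:M) *m Pi x).

(* With K := H this is the coefficient of the xi-equation for w_0, with
   K := calH that of the eta-equation. *)
Definition G0 (J : 'M[C]_m) (Pi : R * R -> 'M[C]_(n, m))
    (S : R * R -> 'M[C]_n) (K : R * R -> 'M[C]_m) (x : R * R) : 'M[C]_m :=
  let Y := J *m (Pi x)^t* *m invmx (S x) *m Pi x in
  - ('i%C *: Y) - mx_comm Y (J *m K x).

Definition darboux_v (J : 'M[C]_m) (calA : 'M[C]_n)
    (Pi : R * R -> 'M[C]_(n, m)) (S : R * R -> 'M[C]_n)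
    (w0 : R * R -> 'M[C]_m) (z : C) (x : R * R) : 'M[C]_m :=
  invmx (w0 x) *m wA J calA Pi S x (z - (x.1 + x.2)%:C%C)^-1.

End Darboux.

(* Main.v *)
(** The equations for Pi and S preserve both A S - S A^* - i Pi J Pi^* and
    A (S - S^* ) A^*, so on the connected set D the displacement identity
    A S - S A^* = i Pi J Pi^* and, since A is invertible, S = S^* persist; no
    uniqueness theorem for differential equations is needed.  Then
    J G_0 is skew-adjoint, so w_0^* J w_0 = J on D and w_0^{-1} J = J w_0^*.
    With lambda = (z - xi - eta)^{-1} one has A' = A^2 and lambda' = lambda^2 in
    either direction, and the displacement identity turns the derivative of w_A
    into G_0 w_A + i lambda (J H w_A - w_A J H); multiplying by w_0^{-1} cancels
    the G_0 term.  The invertibility of A - lambda comes from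
    A - lambda = lambda A (z - calA). *)
Require Import Defs.
From HB Require Import structures.
From mathcomp Require Import all_boot all_order all_algebra perm.
From mathcomp Require Import complex ring lra.
From mathcomp Require Import all_classical all_reals all_analysis.

Import Order.TTheory GRing.Theory Num.Theory.
Import numFieldNormedType.Exports.

Local Open Scope classical_set_scope.
Local Open Scope ring_scope.
Local Open Scope sesquilinear_scope.

(** * Directional derivatives of complex-valued functions *)

Section ComplexDerivative.
Set Implicit Arguments.
Unset Strict Implicit.
Context {R : realType}.
Implicit Types (f g : R * R -> R[i]) (d x : R * R) (a b c : R[i]).

(** Existence and value are bundled in one relation, so that the rules below compose and compute
    derivatives along the way. *)
Definition is_cderive d f x a : Prop :=
  is_derive x d (fun y => complex.Re (f y)) (complex.Re a) /\
  is_derive x d (fun y => complex.Im (f y)) (complex.Im a).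

Lemma is_cderive_eq d x f a b : is_cderive d f x a -> a = b -> is_cderive d f x b.
Proof. by move=> + <-. Qed.

Lemma near_is_cderive d x f g a : (\forall y \near x, f y = g y) ->
  is_cderive d f x a -> is_cderive d g x a.
Proof.
move=> fg [f1 f2]; split.
- by apply: near_eq_is_derive f1; apply: filterS fg => y /= ->.
- by apply: near_eq_is_derive f2; apply: filterS fg => y /= ->.
Qed.

Lemma is_cderive_cst d x c : is_cderive d (fun=> c) x 0.
Proof. by split; exact: is_derive_cst. Qed.

Lemma is_cderiveD d x f g a b : is_cderive d f x a -> is_cderive d g x b ->
  is_cderive d (fun y => f y + g y) x (a + b).
Proof.
move=> [f1 f2] [g1 g2]; split; rewrite raddfD/=.
- by under [X in is_derive _ _ X]funext do rewrite raddfD/=; exact: is_deriveD.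
- by under [X in is_derive _ _ X]funext do rewrite raddfD/=; exact: is_deriveD.
Qed.

Let Re_mulC (u v : R[i]) :
  complex.Re (u * v) = complex.Re u * complex.Re v - complex.Im u * complex.Im v.
Proof. by case: u v => [? ?] []. Qed.

Let Im_mulC (u v : R[i]) :
  complex.Im (u * v) = complex.Re u * complex.Im v + complex.Im u * complex.Re v.
Proof. by case: u v => [? ?] []. Qed.

Lemma is_cderiveM d x f g a b : is_cderive d f x a -> is_cderive d g x b ->
  is_cderive d (fun y => f y * g y) x (a * g x + f x * b).
Proof.
move=> [f1 f2] [g1 g2]; split; rewrite raddfD/= !(Re_mulC, Im_mulC).
- under [X in is_derive _ _ X]funext do rewrite Re_mulC.
  apply: is_derive_eq (is_deriveB (is_deriveM f1 g1) (is_deriveM f2 g2)) _.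
  by rewrite /GRing.scale/=; ring.
- under [X in is_derive _ _ X]funext do rewrite Im_mulC.
  apply: is_derive_eq (is_deriveD (is_deriveM f1 g2) (is_deriveM f2 g1)) _.
  by rewrite /GRing.scale/=; ring.
Qed.

Lemma is_cderive_conj d x f a : is_cderive d f x a ->
  is_cderive d (fun y => (f y)^*) x a^*.
Proof.
have ReJ (u : R[i]) : complex.Re u^* = complex.Re u by case: u.
have ImJ (u : R[i]) : complex.Im u^* = - complex.Im u by case: u.
move=> [f1 f2]; split; rewrite (ReJ, ImJ).
- by under [X in is_derive _ _ X]funext do rewrite ReJ.
- under [X in is_derive _ _ X]funext do rewrite ImJ.
  exact: is_deriveN.
Qed.

(** Since 1/f is the conjugate of f divided by |f|^2, the claim reduces to real products and one
    real inverse. *)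
Lemma is_cderiveV d x f a : f x != 0 -> is_cderive d f x a ->
  is_cderive d (fun y => (f y)^-1) x (- (f x)^-1 ^+ 2 * a).
Proof.
move=> fx0 [f1 f2].
(* [N] is |f|^2, and [dN] is its derivative. *)
pose N y := complex.Re (f y) * complex.Re (f y) + complex.Im (f y) * complex.Im (f y).
have Nx0 : N x != 0.
  move: fx0; rewrite /N; case: (f x) => u v /=; apply: contraNneq => /eqP.
  by rewrite -!expr2 paddr_eq0 ?sqr_ge0// !sqrf_eq0 => /andP[/eqP-> /eqP->].
pose dN := 2 * (complex.Re (f x) * complex.Re a + complex.Im (f x) * complex.Im a).
have derN : is_derive x d N dN.
  apply: is_derive_eq (is_deriveD (is_deriveM f1 f1) (is_deriveM f2 f2)) _.
  by rewrite /dN /GRing.scale/=; ring.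
have derV : is_derive x d (fun y => (N y)^-1) (- N x ^- 2 * dN).
  apply: DeriveDef; first by apply: derivableV => //; case: derN.
  by rewrite deriveV//; case: derN => // _ ->.
have ReV y : complex.Re (f y)^-1 = complex.Re (f y) * (N y)^-1.
  by rewrite /N; case: (f y).
have ImV y : complex.Im (f y)^-1 = - (complex.Im (f y) * (N y)^-1).
  by rewrite /N; case: (f y).
rewrite expr2; split; rewrite mulNr -mulrA raddfN/= !(Re_mulC, Im_mulC) ReV ImV.
- under [X in is_derive _ _ X]funext do rewrite ReV.
  apply: is_derive_eq (is_deriveM f1 derV) _.
  by move: Nx0; rewrite /dN /N /GRing.scale/= => ?; field.
- under [X in is_derive _ _ X]funext do rewrite ImV.
  apply: is_derive_eq (is_deriveN (is_deriveM f2 derV)) _.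
  by move: Nx0; rewrite /dN /N /GRing.scale/= => ?; field.
Qed.
End ComplexDerivative.

(** * Differentiation rules for complex matrix functions *)

Section MatrixPartial.
Set Implicit Arguments.
Unset Strict Implicit.
Context {R : realType}.
Implicit Types (d x : R * R).

Lemma is_mx_partialP p q d (M : R * R -> 'M[R[i]]_(p, q)) x (M' : 'M[R[i]]_(p, q)) :
  is_mx_partial d M x M' <->
  forall i j, is_cderive d (fun y => M y i j) x (M' i j).
Proof.
split=> [[dM <-] i j|dM].
  by have [dRe dIm] := dM i j; rewrite mxE; split; exact: derivableP.
split=> [i j|]; first by have [[? _] [? _]] := dM i j.
apply/matrixP => i j; rewrite mxE; have [[_ ->] [_ ->]] := dM i j.
by case: (M' i j).
Qed.

Lemma is_mx_partial_eq p q d (M : R * R -> 'M[R[i]]_(p, q)) x (M' N' : 'M[R[i]]_(p, q)) :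
  is_mx_partial d M x M' -> M' = N' -> is_mx_partial d M x N'.
Proof. by move=> + <-. Qed.

Lemma is_mx_partial_unique p q d (M : R * R -> 'M[R[i]]_(p, q)) x
    (M' N' : 'M[R[i]]_(p, q)) :
  is_mx_partial d M x M' -> is_mx_partial d M x N' -> M' = N'.
Proof. by move=> [_ <-] [_ <-]. Qed.

Lemma near_is_mx_partial p q d (M N : R * R -> 'M[R[i]]_(p, q)) x
    (M' : 'M[R[i]]_(p, q)) :
  (\forall y \near x, M y = N y) -> is_mx_partial d M x M' -> is_mx_partial d N x M'.
Proof.
move=> MN /is_mx_partialP dM; apply/is_mx_partialP => i j.
by apply: near_is_cderive (dM i j); apply: filterS MN => y /= ->.
Qed.

Lemma is_mx_partial_cst p q d x (M : 'M[R[i]]_(p, q)) :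
  is_mx_partial d (fun=> M) x 0.
Proof. by apply/is_mx_partialP => i j; rewrite mxE; exact: is_cderive_cst. Qed.

Lemma is_mx_partialD p q d (M N : R * R -> 'M[R[i]]_(p, q)) x
    (M' N' : 'M[R[i]]_(p, q)) :
  is_mx_partial d M x M' -> is_mx_partial d N x N' ->
  is_mx_partial d (fun y => M y + N y) x (M' + N').
Proof.
move=> /is_mx_partialP dM /is_mx_partialP dN; apply/is_mx_partialP => i j.
by under [X in is_cderive _ X]funext do rewrite mxE; rewrite mxE; exact: is_cderiveD.
Qed.

Lemma is_mx_partialZ p q d (c : R * R -> R[i]) (M : R * R -> 'M[R[i]]_(p, q)) x
    (c' : R[i]) (M' : 'M[R[i]]_(p, q)) :
  is_cderive d c x c' -> is_mx_partial d M x M' ->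
  is_mx_partial d (fun y => c y *: M y) x (c' *: M x + c x *: M').
Proof.
move=> dc /is_mx_partialP dM; apply/is_mx_partialP => i j.
by under [X in is_cderive _ X]funext do rewrite mxE; rewrite !mxE; exact: is_cderiveM.
Qed.

Lemma is_mx_partialZl p q d (c : R[i]) (M : R * R -> 'M[R[i]]_(p, q)) x
    (M' : 'M[R[i]]_(p, q)) :
  is_mx_partial d M x M' -> is_mx_partial d (fun y => c *: M y) x (c *: M').
Proof.
move=> dM; apply: is_mx_partial_eq (is_mx_partialZ (is_cderive_cst d x c) dM) _.
by rewrite scale0r add0r.
Qed.

Lemma is_mx_partialN p q d (M : R * R -> 'M[R[i]]_(p, q)) x (M' : 'M[R[i]]_(p, q)) :
  is_mx_partial d M x M' -> is_mx_partial d (fun y => - M y) x (- M').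
Proof.
by move=> /(is_mx_partialZl (-1)); under [fun y => _]funext do rewrite scaleN1r;
  rewrite scaleN1r.
Qed.

Lemma is_mx_partialB p q d (M N : R * R -> 'M[R[i]]_(p, q)) x
    (M' N' : 'M[R[i]]_(p, q)) :
  is_mx_partial d M x M' -> is_mx_partial d N x N' ->
  is_mx_partial d (fun y => M y - N y) x (M' - N').
Proof. by move=> dM /is_mx_partialN; exact: is_mx_partialD. Qed.

Lemma is_cderive_sum I (r : seq I) d (f : I -> R * R -> R[i]) x (f' : I -> R[i]) :
  (forall i, is_cderive d (f i) x (f' i)) ->
  is_cderive d (fun y => \sum_(i <- r) f i y) x (\sum_(i <- r) f' i).
Proof.
move=> df; elim: r => [|i r IH].
  rewrite big_nil; under [X in is_cderive _ X]funext do rewrite big_nil.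
  exact: is_cderive_cst.
rewrite big_cons; under [X in is_cderive _ X]funext do rewrite big_cons.
exact: is_cderiveD.
Qed.

Lemma is_mx_partialM p q r d (M : R * R -> 'M[R[i]]_(p, q))
    (N : R * R -> 'M[R[i]]_(q, r)) x (M' : 'M[R[i]]_(p, q)) (N' : 'M[R[i]]_(q, r)) :
  is_mx_partial d M x M' -> is_mx_partial d N x N' ->
  is_mx_partial d (fun y => M y *m N y) x (M' *m N x + M x *m N').
Proof.
move=> /is_mx_partialP dM /is_mx_partialP dN; apply/is_mx_partialP => i j.
under [X in is_cderive _ X]funext do rewrite mxE.
rewrite !mxE -big_split/=; apply: is_cderive_sum => k.
exact: is_cderiveM.
Qed.

Lemma is_mx_partialMl p q r d (M : 'M[R[i]]_(p, q)) (N : R * R -> 'M[R[i]]_(q, r)) x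
    (N' : 'M[R[i]]_(q, r)) :
  is_mx_partial d N x N' -> is_mx_partial d (fun y => M *m N y) x (M *m N').
Proof.
move=> dN; apply: is_mx_partial_eq (is_mx_partialM (is_mx_partial_cst d x M) dN) _.
by rewrite mul0mx add0r.
Qed.

Lemma is_mx_partialMr p q r d (M : R * R -> 'M[R[i]]_(p, q)) (N : 'M[R[i]]_(q, r)) x
    (M' : 'M[R[i]]_(p, q)) :
  is_mx_partial d M x M' -> is_mx_partial d (fun y => M y *m N) x (M' *m N).
Proof.
move=> dM; apply: is_mx_partial_eq (is_mx_partialM dM (is_mx_partial_cst d x N)) _.
by rewrite mulmx0 addr0.
Qed.

Lemma is_mx_partial_adj p q d (M : R * R -> 'M[R[i]]_(p, q)) x
    (M' : 'M[R[i]]_(p, q)) :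
  is_mx_partial d M x M' -> is_mx_partial d (fun y => (M y)^t* ) x (M'^t* ).
Proof.
move=> /is_mx_partialP dM; apply/is_mx_partialP => i j.
by under [X in is_cderive _ X]funext do rewrite !mxE; rewrite !mxE;
  exact: is_cderive_conj.
Qed.

(** Here and for determinants only the existence of a derivative matters: the value for the inverse
    matrix is found without expanding it. *)
Let ex_prod I (r : seq I) d (f : I -> R * R -> R[i]) x :
  (forall i, exists f', is_cderive d (f i) x f') ->
  exists f', is_cderive d (fun y => \prod_(i <- r) f i y) x f'.
Proof.
move=> df; elim: r => [|i r [b db]].
  by exists 0; under [X in is_cderive _ X]funext do rewrite big_nil;
    exact: is_cderive_cst.
have [a da] := df i; eexists; under [X in is_cderive _ X]funext do rewrite big_cons.
exact: is_cderiveM da db.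
Qed.

Let ex_det n d (M : R * R -> 'M[R[i]]_n) x :
  (forall i j, exists a, is_cderive d (fun y => M y i j) x a) ->
  exists a, is_cderive d (fun y => \det (M y)) x a.
Proof.
move=> dM; rewrite /determinant.
have /choice[f' df] : forall s : 'S_n, exists a, is_cderive d
    (fun y => (-1) ^+ s * \prod_i M y i (s i)) x a.
  move=> s; have [i|a da] := @ex_prod _ (index_enum 'I_n) d
    (fun i y => M y i (s i)) x; first exact: dM.
  by eexists; exact: is_cderiveM (is_cderive_cst d x _) da.
by eexists; exact: is_cderive_sum df.
Qed.

Lemma is_mx_partialV n d (M : R * R -> 'M[R[i]]_n) x (M' : 'M[R[i]]_n) :
  (\forall y \near x, M y \in unitmx) -> is_mx_partial d M x M' ->
  is_mx_partial d (fun y => invmx (M y)) x (- (invmx (M x) *m M' *m invmx (M x))).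
Proof.
move=> Mu dM; have Mxu : M x \in unitmx := nbhs_singleton Mu.
(* Differentiability comes from the cofactor formula; the value of the
   derivative then follows by differentiating M^-1 M = 1. *)
suff [N dN] : exists N, is_mx_partial d (fun y => invmx (M y)) x N.
  have : is_mx_partial d (fun y => invmx (M y) *m M y) x 0.
    apply: near_is_mx_partial (is_mx_partial_cst d x 1%:M).
    by apply: filterS Mu => y /= Myu; rewrite mulVmx.
  move=> /(is_mx_partial_unique (is_mx_partialM dN dM)) /eqP.
  rewrite addr_eq0 => /eqP /(congr1 (mulmxr (invmx (M x)))) /=.
  rewrite mulmxK// => NE.
  by apply: is_mx_partial_eq dN _; rewrite NE mulNmx.
have dMij i j : exists a, is_cderive d (fun y => M y i j) x a.
  by exists (M' i j); move/is_mx_partialP : dM; exact.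
(* The adjugate is the transposed cofactor matrix, hence the swapped indices. *)
have /choice[f df] : forall ij : 'I_n * 'I_n, exists a,
    is_cderive d (fun y => (\det (M y))^-1 * cofactor (M y) ij.2 ij.1) x a.
  move=> [i j]; have [a da] := ex_det dMij.
  have [b db] : exists b,
      is_cderive d (fun y => \det (row' j (col' i (M y)))) x b.
    by apply: ex_det => k l; under [X in is_cderive _ X]funext do rewrite !mxE.
  eexists; apply: is_cderiveM (is_cderiveV _ da) (is_cderiveM (is_cderive_cst _ _ _) db).
  by move: Mxu; rewrite unitmxE unitfE.
exists (\matrix_(i, j) f (i, j)); apply/is_mx_partialP => i j; rewrite mxE.
(* [invmx] is given by the cofactor formula only at invertible arguments, so the two functions are
   compared near x. *)
apply: near_is_cderive (df (i, j)).
by apply: filterS Mu => y /= Myu; rewrite /invmx Myu !mxE.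
Qed.

End MatrixPartial.

(** * Functions with vanishing partial derivatives *)

Section LocallyConstant.
Set Implicit Arguments.
Unset Strict Implicit.
Context {R : realType}.
Implicit Types (f : R * R -> R) (x y d : R * R).

(** The two difference quotients are the same function of the increment. *)
Lemma is_derive_line f x d (h a : R) : is_derive (h *: d + x) d f a ->
  is_derive h 1 (fun t => f (t *: d + x)) a.
Proof.
have E : (fun k => k^-1 *: (((fun t => f (t *: d + x)) \o shift h) (k *: 1) -
                            f (h *: d + x))) =
         (fun k => k^-1 *: ((f \o shift (h *: d + x)) (k *: d) - f (h *: d + x))).
  by apply/funext => k /=; rewrite [k *: 1]mulr1 scalerDl addrA.
move=> [df dfa]; split; first by rewrite /derivable E.
by rewrite /derive E.
Qed.

(** Mean value theorem for the restriction of [f] to the line; [min] and [max] leave the order of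
    the endpoints free. *)
Lemma derive0_line_cst f x d (a b : R) :
  (forall h, Num.min a b <= h <= Num.max a b -> is_derive (h *: d + x) d f 0) ->
  f (a *: d + x) = f (b *: d + x).
Proof.
wlog ab : a b / a <= b => [WL|].
  case/orP: (le_total a b) => ab df; first exact: WL.
  by symmetry; apply: WL => // h; rewrite minC maxC; exact: df.
rewrite (min_idPl ab) (max_idPr ab) => df.
pose g t := f (t *: d + x); rewrite -/(g a) -/(g b).
have dg h : h \in `[a, b]%R -> is_derive h 1 g 0.
  by rewrite in_itv => /df; exact: is_derive_line.
have cg : {within `[a, b], continuous g}.
  by apply: derivable_within_continuous => h /dg [].
have dg' h : h \in `]a, b[%R -> is_derive h 1 g 0.
  by move=> hab; apply: dg; exact: subset_itv_oo_cc.
have [c _] := MVT_segment ab dg' cg.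
by rewrite mul0r => /eqP; rewrite subr_eq0 => /eqP.
Qed.

(** Balls of the product are squares, so x is joined to y inside a ball by a horizontal and then a
    vertical segment, with corner [(y.1, x.2)]. *)
Lemma partials0_locally_cst (D : set (R * R)) f x : open D -> D x ->
  (forall y, D y -> is_derive y dxi f 0 /\ is_derive y deta f 0) ->
  \forall y \near x, f y = f x.
Proof.
move=> oD Dx df; have : nbhs x D by exact: open_nbhs_nbhs.
move=> /nbhs_ballP[e /= e0 xeD]; apply/nbhs_ballP; exists e => //= y [y1 y2].
(* A number between the centre [a] and a point of the ball is in the ball; this keeps both segments
   in [D]. *)
have btw (a b h : R) : ball a e b -> Num.min a b <= h <= Num.max a b -> ball a e h.
  rewrite /ball/= !ltr_distlC => /andP[? ?].
  by rewrite ge_min le_max => /andP[/orP[] ? /orP[] ?]; lra.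
have h1 (h : R) : h *: dxi + (0, x.2) = (h, x.2).
  by congr pair; rewrite /= ?mulr1 ?scaler0 ?addr0 ?add0r// [_ *: _]mulr1.
have h2 (h : R) : h *: deta + (y.1, 0) = (y.1, h).
  by congr pair; rewrite /= ?scaler0 ?addr0 ?add0r// [_ *: _]mulr1.
transitivity (f (y.1, x.2)).
  have := @derive0_line_cst f (y.1, 0) deta x.2 y.2.
  rewrite !h2 -surjective_pairing => E; symmetry; apply: E => h hxy; rewrite h2.
  by apply: (df _ _).2; apply: xeD; split => //=; exact: btw hxy.
have := @derive0_line_cst f (0, x.2) dxi x.1 y.1.
rewrite !h1 -surjective_pairing => E; symmetry; apply: E => h hxy; rewrite h1.
by apply: (df _ _).1; apply: xeD; split => //=; [exact: btw hxy|exact: ballxx].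
Qed.

(** The level set of [f] through y is nonempty, open and closed relative to [D]. *)
Lemma partials0_cst (D : set (R * R)) f x y : open D -> connected D -> D x -> D y ->
  (forall u, D u -> is_derive u dxi f 0 /\ is_derive u deta f 0) -> f x = f y.
Proof.
move=> oD cD Dx Dy df.
have loc u : D u -> \forall w \near u, f w = f u.
  by move=> Du; exact: partials0_locally_cst df.
(* By local constancy any condition on the value of [f] cuts out an open set. Applied to equality
   and to its negation, this gives openness and relative closedness. *)
have opn (P : R -> Prop) : open [set u | D u /\ P (f u)].
  rewrite openE => u [Du Pu]; rewrite /interior/=.
  have Du' : \forall w \near u, D w by exact: open_nbhs_nbhs.
  near=> w; split; first by near: w.
  by rewrite (near (loc u Du) w).
have oN := opn (fun t => t != f y); have oE := opn (fun t => t = f y).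
have : [set u | D u /\ f u = f y] = D.
  apply: cD; first by exists y.
  - by exists [set u | D u /\ f u = f y] => //; apply/seteqP; split=> [u []|u []].
  - exists (~` [set u | D u /\ f u != f y]); first exact: open_closedC.
    apply/seteqP; split=> u /= [Du fu]; split=> //.
      by case=> _; rewrite fu eqxx.
    by apply/eqP; apply: contra_notT fu.
by move=> /seteqP[_ /(_ _ Dx) []].
Unshelve. all: by end_near. Qed.
End LocallyConstant.

(** * Noncommutative matrix identities behind the derivatives *)

Section Algebra.
Set Implicit Arguments.
Unset Strict Implicit.
Context {C : comNzRingType} (i : C) (ii : i * i = -1).

Let mxDE p q (M N : 'M[C]_(p, q)) k l : (M + N) k l = M k l + N k l.
Proof. by rewrite mxE. Qed.
Let mxNE p q (M : 'M[C]_(p, q)) k l : (- M) k l = - M k l.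
Proof. by rewrite mxE. Qed.
Let mxZE p q c (M : 'M[C]_(p, q)) k l : (c *: M) k l = c * M k l.
Proof. by rewrite mxE. Qed.
Let mx0E p q k l : (0 : 'M[C]_(p, q)) k l = 0.
Proof. by rewrite mxE. Qed.

(** Once products are expanded into left-associated monomials, an identity becomes linear in these
    monomials. Entrywise they are atoms for [ring], which also uses i^2 = -1. *)
Ltac mx_distr := rewrite ?(mulmxDl, mulmxDr, mulNmx, mulmxN, scalerDr, scalerN,
  =^~ scalemxAl, =^~ scalemxAr, scalerA, mulmxA, mulmx1, mul1mx, opprD, opprK).
Ltac mx_entries := apply/matrixP => ? ?; rewrite ?(mxDE, mxNE, mxZE, mx0E).
Ltac mx_ring := mx_entries; ring: ii.

(** [As] and [Ps] stand for A^* and Pi^*. The terms of A' = A^2 and of its adjoint cancel those of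
    -(AS + SA^* ) in S'; the remaining term of S' cancels the derivative of i Pi J Pi^*. *)
Lemma displacement_derivative0 m n (A As S : 'M[C]_n) (P : 'M[C]_(n, m))
    (Ps : 'M[C]_(m, n)) (J H : 'M[C]_m) :
  let S' := P *m J *m H *m J *m Ps - (A *m S + S *m As) in
  A *m A *m S + A *m S' - (S' *m As + S *m (As *m As))
    - i *: (- (i *: (A *m P *m J *m H)) *m J *m Ps +
               P *m J *m (i *: (H *m J *m Ps *m As))) = 0.
Proof. by rewrite /=; mx_distr; mx_ring. Qed.

(** With T = S - S^* one has T' = -(AT + TA^* ), and the outer factors in A T A^* compensate because
    A' = A^2. *)
Lemma congruence_derivative0 n (A As T : 'M[C]_n) :
  (A *m A *m T + A *m (- (A *m T + T *m As))) *m As + A *m T *m (As *m As) = 0.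
Proof. by mx_distr; mx_entries; ring. Qed.

(** For self-adjoint J, H and X, the first summand is G^* J with G = -iJX - [JX, JH], and the second
    is J G. *)
Lemma gauge_skew m (J H X : 'M[C]_m) : J *m J = 1%:M ->
  (i *: X - (H *m J *m X - X *m J *m H)) +
  J *m (- (i *: (J *m X)) - (J *m X *m (J *m H) - J *m H *m (J *m X))) = 0.
Proof. by move=> JJ; mx_distr; rewrite JJ; mx_distr; mx_ring. Qed.

(** The left side is the product rule applied to [W], with [Si] = S^-1 and [Ri] = (A - l)^-1. The
    relations eliminate every [A] and [As], leaving monomials in J, H, [P], [Ps], [Si] and [Ri]. *)
Lemma transfer_derivative m n (l : C) (A As S Si Ri : 'M[C]_n)
    (P : 'M[C]_(n, m)) (Ps : 'M[C]_(m, n)) (J H : 'M[C]_m) :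
  J *m J = 1%:M -> Si *m S = 1%:M -> S *m Si = 1%:M ->
  (A - l%:M) *m Ri = 1%:M -> Ri *m (A - l%:M) = 1%:M ->
  A *m S - S *m As = i *: (P *m J *m Ps) ->
  let K := J *m H in
  let S' := P *m J *m H *m J *m Ps - (A *m S + S *m As) in
  let Y := J *m Ps *m Si *m P in
  let W := 1%:M - i *: (J *m Ps *m Si *m Ri *m P) in
  - (i *: (((J *m (i *: (H *m J *m Ps *m As)) *m Si
               + J *m Ps *m - (Si *m S' *m Si)) *m Ri
               + J *m Ps *m Si *m - (Ri *m (A *m A - (l ^+ 2)%:M) *m Ri)) *m P
               + J *m Ps *m Si *m Ri *m - (i *: (A *m P *m J *m H)))) =
  (- (i *: Y) - (Y *m K - K *m Y)) *m W + (i * l) *: (K *m W - W *m K).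
Proof.
move=> JJ SiS SSi AR RA SA /=.
have ARi : A *m Ri = 1%:M + l *: Ri.
  by apply/eqP; rewrite -subr_eq -AR mulmxBl mul_scalar_mx.
have RiA : Ri *m A = 1%:M + l *: Ri.
  by apply/eqP; rewrite -subr_eq -RA mulmxBr mul_mx_scalar.
(* The displacement identity multiplied by S^-1 on both sides; it moves [As] through [Si] as [A]. *)
have AsSi : As *m Si = Si *m A - i *: (Si *m P *m J *m Ps *m Si).
  have := congr1 (fun M => Si *m M *m Si) SA.
  rewrite -scalemxAr -scalemxAl !mulmxA => <-.
  rewrite mulmxBr mulmxBl !mulmxA SiS mul1mx -!(mulmxA _ S) SSi mulmx1.
  by rewrite opprB addrC subrK.
(* The primed forms carry a prefix [Z], because in left-associated monomials the factors to be
   rewritten follow other factors. *)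
have JJ' p (Z : 'M[C]_(p, m)) : Z *m J *m J = Z by rewrite -mulmxA JJ mulmx1.
have SSi' p (Z : 'M[C]_(p, n)) : Z *m S *m Si = Z by rewrite -mulmxA SSi mulmx1.
have AsSi' p (Z : 'M[C]_(p, n)) : Z *m As *m Si =
   Z *m Si *m A - i *: (Z *m Si *m P *m J *m Ps *m Si).
  by rewrite -mulmxA AsSi; mx_distr.
have ARi' p (Z : 'M[C]_(p, n)) : Z *m A *m Ri = Z + l *: (Z *m Ri).
  by rewrite -mulmxA ARi; mx_distr.
have RiA' p (Z : 'M[C]_(p, n)) : Z *m Ri *m A = Z + l *: (Z *m Ri).
  by rewrite -mulmxA RiA; mx_distr.
(* Reducing by these relations gives both sides a common normal form. *)
have -> : Ri *m (A *m A - (l ^+ 2)%:M) *m Ri = 1%:M + (2 * l) *: Ri.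
  rewrite mulmxBr mulmxBl !mulmxA -[X in X - _]mulmxA ARi RiA mul_mx_scalar.
  by mx_distr; mx_ring.
have -> : - (Si *m (P *m J *m H *m J *m Ps - (A *m S + S *m As)) *m Si) =
    Si *m A + Si *m A - i *: (Si *m P *m J *m Ps *m Si)
    - Si *m P *m J *m H *m J *m Ps *m Si.
  by mx_distr; rewrite SiS SSi' mul1mx AsSi; mx_distr; mx_ring.
mx_distr; rewrite !AsSi'; mx_distr; rewrite !ARi' RiA' ?JJ'; mx_distr.
by mx_ring.
Qed.
End Algebra.

(** * Adjoints, and the dependence of A and lambda on the point *)

Section Darboux.
Set Implicit Arguments.
Unset Strict Implicit.
Context {R : realType}.
Implicit Types (d x : R * R).

Lemma mx_partials0_cst p q (D : set (R * R)) (M : R * R -> 'M[R[i]]_(p, q)) x y :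
  open D -> connected D -> D x -> D y ->
  (forall u, D u -> is_mx_partial dxi M u 0 /\ is_mx_partial deta M u 0) ->
  M x = M y.
Proof.
move=> oD cD Dx Dy dM; apply/matrixP => i j.
suff ReIm : complex.Re (M x i j) = complex.Re (M y i j) /\
            complex.Im (M x i j) = complex.Im (M y i j).
  by move: ReIm; case: (M x i j) (M y i j) => [? ?] [? ?] [/= -> ->].
have dMij u : D u -> is_cderive dxi (fun y => M y i j) u 0 /\
                     is_cderive deta (fun y => M y i j) u 0.
  move=> /dM[/is_mx_partialP/(_ i j) + /is_mx_partialP/(_ i j)].
  by rewrite mxE.
split.
- by apply: (@partials0_cst R D (fun y => complex.Re (M y i j)) _ _ oD cD Dx Dy);
    move=> u /dMij[[? _] [? _]].
- by apply: (@partials0_cst R D (fun y => complex.Im (M y i j)) _ _ oD cD Dx Dy);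
    move=> u /dMij[[_ ?] [_ ?]].
Qed.

Lemma mulmx_adj p q r (M : 'M[R[i]]_(p, q)) (N : 'M[R[i]]_(q, r)) :
  (M *m N)^t* = N^t* *m M^t*.
Proof. by rewrite trmx_mul map_mxM. Qed.

Lemma mxD_adj p q (M N : 'M[R[i]]_(p, q)) : (M + N)^t* = M^t* + N^t*.
Proof. by rewrite raddfD/= map_mxD. Qed.

Lemma mxN_adj p q (M : 'M[R[i]]_(p, q)) : (- M)^t* = - M^t*.
Proof. by rewrite raddfN/= map_mxN. Qed.

Lemma mxZ_adj p q (c : R[i]) (M : 'M[R[i]]_(p, q)) : (c *: M)^t* = c^* *: M^t*.
Proof. by rewrite linearZ/= map_mxZ. Qed.

Lemma invmx_adj n (M : 'M[R[i]]_n) : (invmx M)^t* = invmx (M^t* ).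
Proof. by rewrite trmx_inv map_invmx. Qed.

Lemma is_cderive_coord_sum d x :
  is_cderive d (fun y => (y.1 + y.2)%:C%C) x (d.1 + d.2)%:C%C.
Proof.
split; last exact: is_derive_cst.
rewrite /=.
have E : (fun h : R => h^-1 *: (((fun y : R * R => y.1 + y.2) \o shift x) (h *: d)
    (* The coordinate sum is linear, so its difference quotient is constant for h nonzero. *)
    - (x.1 + x.2))) @ 0^' --> d.1 + d.2.
  apply: cvg_near_cst; near=> h.
  have h0 : h != 0 by near: h; exact: nbhs_dnbhs_neq.
  by rewrite /= /GRing.scale/=; field.
by split; [apply/cvg_ex; eexists; exact: E|exact: (cvg_lim _ E)].
Unshelve. all: by end_near. Qed.

(** The condition on [d] makes the derivative of calA - (xi + eta) equal to -1, and the rule for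
    inverses turns this into A^2. Both coordinate directions satisfy it. *)
Lemma is_mx_partial_Amx n d (calA : 'M[R[i]]_n) x : d.1 + d.2 = 1 ->
  (\forall y \near x, calA - (y.1 + y.2)%:C%C%:M \in unitmx) ->
  is_mx_partial d (Amx calA) x (Amx calA x *m Amx calA x).
Proof.
move=> d1 calAu; apply: is_mx_partial_eq (is_mx_partialV (M' := - 1%:M) calAu _) _.
  have ds := is_mx_partialZ (is_cderive_coord_sum d x) (is_mx_partial_cst d x 1%:M).
  have := is_mx_partialB (is_mx_partial_cst d x calA) (ds n).
  under [fun y => _ - _]funext do rewrite scalemx1.
  move=> dM; apply: is_mx_partial_eq dM _.
  by rewrite scaler0 addr0 d1 scale1r add0r.
by rewrite mulmxN mulmx1 mulNmx opprK.
Qed.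

Lemma is_cderive_lambda d x (z : R[i]) : d.1 + d.2 = 1 ->
  z != (x.1 + x.2)%:C%C ->
  is_cderive d (fun y => (z - (y.1 + y.2)%:C%C)^-1) x ((z - (x.1 + x.2)%:C%C)^-1 ^+ 2).
Proof.
move=> d1 zx.
have dc := is_cderiveM (is_cderive_cst d x (-1)) (is_cderive_coord_sum d x).
have := is_cderiveD (is_cderive_cst d x z) dc.
under [fun y => _ + _]funext do rewrite mulN1r.
move=> /(is_cderiveV _); rewrite subr_eq0 => /(_ zx) dl; apply: is_cderive_eq dl _.
by rewrite d1 mul0r !add0r mulN1r mulrNN mulr1.
Qed.

(** A non-real z never equals a real sum; for real z, the sum is continuous and the complement of a
    point is open. *)
Lemma coord_sum_neq_near x (z : R[i]) : z != (x.1 + x.2)%:C%C ->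
  \forall y \near x, z != (y.1 + y.2)%:C%C.
Proof.
have E (t : R) : (z != t%:C%C) = (complex.Im z != 0) || (t != complex.Re z).
  by rewrite eq_complex negb_and orbC (eq_sym t).
rewrite E => /orP[zx|zx]; first by near=> y; rewrite E zx.
have zn : \forall y \near x, y.1 + y.2 != complex.Re z.
  have sc : (fun y : R * R => y.1 + y.2) @ x --> x.1 + x.2.
    by apply: cvgD; [exact: cvg_fst|exact: cvg_snd].
  by apply: (sc [set t | t != complex.Re z]); apply: open_nbhs_nbhs; split;
    [exact: open_neq|].
by near=> y; rewrite E; apply/orP; right; near: y.
Unshelve. all: by end_near. Qed.

(** With s = xi + eta, write z - calA = (z - s) - (calA - s). This resolvent factorization reduces
    invertibility of A - lambda to z being outside the spectrum. *)
Lemma Amx_sub_scalar n (calA : 'M[R[i]]_n) (z : R[i]) x :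
  calA - (x.1 + x.2)%:C%C%:M \in unitmx -> z != (x.1 + x.2)%:C%C ->
  Amx calA x - (z - (x.1 + x.2)%:C%C)^-1%:M =
    (z - (x.1 + x.2)%:C%C)^-1 *: (Amx calA x *m (z%:M - calA)).
Proof.
move=> calAu zx; set s := (x.1 + x.2)%:C%C in calAu zx *.
have -> : z%:M - calA = (z - s)%:M - (calA - s%:M).
  by rewrite raddfB opprB addrA subrK.
rewrite mulmxBr mulVmx// mul_mx_scalar scalerBr scalerA mulVf ?subr_eq0// scale1r.
by rewrite scalemx1.
Qed.

Lemma Amx_sub_unit n (calA : 'M[R[i]]_n) (z : R[i]) x :
  calA - (x.1 + x.2)%:C%C%:M \in unitmx -> z != (x.1 + x.2)%:C%C ->
  ~~ eigenvalue calA z ->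
  Amx calA x - (z - (x.1 + x.2)%:C%C)^-1%:M \in unitmx.
Proof.
(* Not being an eigenvalue means that calA - z has trivial kernel, hence is invertible. *)
move=> calAu zx; rewrite /eigenvalue negbK kermx_eq0 row_free_unit => zu.
rewrite Amx_sub_scalar// unitmxZ ?unitfE ?invr_eq0 ?subr_eq0//.
by rewrite unitmx_mul unitmx_inv calAu -opprB -scaleN1r unitmxZ// unitrN1.
Qed.

End Darboux.

(** * Conserved quantities and the transfer function along one direction *)

Section Conservation.
Set Implicit Arguments.
Unset Strict Implicit.
Context {R : realType} {m n : nat}.
Implicit Types (d x : R * R).
(** The xi- and eta-equations have the same shape: [K] is H along xi and calH along eta, so each
    lemma serves twice. *)
Context (J : 'M[R[i]]_m) (K : R * R -> 'M[R[i]]_m) (A S : R * R -> 'M[R[i]]_n).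
Context (Pi : R * R -> 'M[R[i]]_(n, m)) (d x : R * R).
Context (J_adj : J = J^t* ) (JJ : J *m J = 1%:M) (K_adj : K x = (K x)^t* ).
Context (dA : is_mx_partial d A x (A x *m A x)).
Context (dPi : is_mx_partial d Pi x (- ('i%C *: (A x *m Pi x *m J *m K x)))).
Context (dS : is_mx_partial d S x
  (Pi x *m J *m K x *m J^t* *m (Pi x)^t* - (A x *m S x + S x *m (A x)^t* ))).

Let ii : 'i%C * 'i%C = -1 :> R[i].
Proof. by rewrite -expr2 sqr_i. Qed.

Lemma conj_i : ('i%C : R[i])^* = - 'i%C.
Proof. by rewrite complexiE conjCi. Qed.

Let dPis : is_mx_partial d (fun y => (Pi y)^t* ) x
  ('i%C *: (K x *m J *m (Pi x)^t* *m (A x)^t* )).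
Proof.
apply: is_mx_partial_eq (is_mx_partial_adj dPi) _.
rewrite mxN_adj mxZ_adj !mulmx_adj -K_adj -J_adj -!mulmxA.
by rewrite (_ : 'i%C^* = - 'i%C) ?scaleNr ?opprK//; exact: conj_i.
Qed.

Lemma is_mx_partial_displacement :
  is_mx_partial d (fun y => A y *m S y - S y *m (A y)^t*
                            - 'i%C *: (Pi y *m J *m (Pi y)^t* )) x 0.
Proof.
have dAs := is_mx_partial_adj dA; rewrite mulmx_adj in dAs.
apply: is_mx_partial_eq (is_mx_partialB (is_mx_partialB (is_mx_partialM dA dS)
  (is_mx_partialM dS dAs)) (is_mx_partialZl 'i%C
  (is_mx_partialM (is_mx_partialMr J dPi) dPis))) _.
rewrite -J_adj; exact: displacement_derivative0.
Qed.

Lemma is_mx_partial_congruence :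
  is_mx_partial d (fun y => A y *m (S y - (S y)^t* ) *m (A y)^t* ) x 0.
Proof.
have dAs := is_mx_partial_adj dA; rewrite mulmx_adj in dAs.
have dT : is_mx_partial d (fun y => S y - (S y)^t* ) x
    (- (A x *m (S x - (S x)^t* ) + (S x - (S x)^t* ) *m (A x)^t* )).
  apply: is_mx_partial_eq (is_mx_partialB dS (is_mx_partial_adj dS)) _.
  rewrite !(mxD_adj, mxN_adj, mulmx_adj, trmxCK) -K_adj -J_adj !mulmxA.
  (* Here [u] is the self-adjoint term Pi J K J^* Pi^*, which drops out of S' minus its adjoint. *)
  have E (V : zmodType) (u v w : V) : u - v - (u - w) = w - v.
    by rewrite opprB addrC addrA subrK.
  rewrite E mulmxBl mulmxBr -opprB; congr (- _).
  by rewrite [X in _ - X]addrC opprD addrACA.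
apply: is_mx_partial_eq (is_mx_partialM (is_mx_partialM dA dT) dAs) _.
exact: congruence_derivative0.
Qed.

(** Self-adjointness of S makes X = Pi^* S^-1 Pi self-adjoint, and [gauge_skew] applies to it. *)
Lemma G0_skew : S x = (S x)^t* ->
  (G0 J Pi S K x)^t* *m J + J *m G0 J Pi S K x = 0.
Proof.
move=> S_adj; pose X := (Pi x)^t* *m invmx (S x) *m Pi x.
have XE : X^t* = X.
  by rewrite /X !mulmx_adj trmxCK invmx_adj -S_adj mulmxA.
have -> : G0 J Pi S K x =
    - ('i%C *: (J *m X)) - (J *m X *m (J *m K x) - J *m K x *m (J *m X)).
  by rewrite /G0 /mx_comm /X !mulmxA.
rewrite -[RHS](gauge_skew ii (K x) X JJ).
move: X XE => X XE; congr (_ + _).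
rewrite !(mxD_adj, mxN_adj, mxZ_adj, mulmx_adj) -K_adj -J_adj XE.
by rewrite conj_i scaleNr opprK !mulmxBl -scalemxAl -!mulmxA JJ !mulmx1.
Qed.

(** The derivative is w^* (G^* J + J G) w. *)
Lemma is_mx_partial_gauge (w : R * R -> 'M[R[i]]_m) (G : 'M[R[i]]_m) :
  G^t* *m J + J *m G = 0 -> is_mx_partial d w x (G *m w x) ->
  is_mx_partial d (fun y => (w y)^t* *m J *m w y) x 0.
Proof.
move=> GJ dw; apply: is_mx_partial_eq
  (is_mx_partialM (is_mx_partialMr J (is_mx_partial_adj dw)) dw) _.
rewrite mulmx_adj -!mulmxA -mulmxDr !mulmxA -mulmxDl.
by rewrite GJ mul0mx mulmx0.
Qed.

(** The function [l] abstracts lambda; the only differential fact about it is l' = l^2, parallel to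
    A' = A^2. *)
Lemma is_mx_partial_wA (l : R * R -> R[i]) :
  (\forall y \near x, S y \in unitmx) ->
  (\forall y \near x, A y - (l y)%:M \in unitmx) ->
  is_cderive d l x (l x ^+ 2) ->
  A x *m S x - S x *m (A x)^t* = 'i%C *: (Pi x *m J *m (Pi x)^t* ) ->
  let W y := 1%:M - 'i%C *: (J *m (Pi y)^t* *m invmx (S y)
                             *m invmx (A y - (l y)%:M) *m Pi y) in
  is_mx_partial d W x (G0 J Pi S K x *m W x
    + ('i%C * l x) *: (J *m K x *m W x - W x *m (J *m K x))).
Proof.
move=> Su Alu dl SA W.
have Sxu : S x \in unitmx := nbhs_singleton Su.
have Alxu : A x - (l x)%:M \in unitmx := nbhs_singleton Alu.
have dAl : is_mx_partial d (fun y => A y - (l y)%:M) x (A x *m A x - (l x ^+ 2)%:M).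
  have := is_mx_partialB dA (is_mx_partialZ dl (is_mx_partial_cst d x 1%:M)).
  under [fun y => _ - _]funext do rewrite scalemx1.
  by rewrite scalemx1 scaler0 addr0.
have dW := is_mx_partialB (is_mx_partial_cst d x 1%:M) (is_mx_partialZl 'i%C
  (is_mx_partialM (is_mx_partialM (is_mx_partialM (is_mx_partialMl J dPis)
     (is_mx_partialV Su dS)) (is_mx_partialV Alu dAl)) dPi)).
apply: is_mx_partial_eq dW _.
rewrite sub0r -J_adj.
apply: (transfer_derivative ii (S := S x)) => //.
- exact: mulVmx.
- exact: mulmxV.
- exact: mulmxV.
- exact: mulVmx.
Qed.

Lemma is_mx_partial_gauge_transform (w W : R * R -> 'M[R[i]]_m) (c : R[i])
    (G : 'M[R[i]]_m) :
  (\forall y \near x, w y \in unitmx) -> (w x)^t* *m J *m w x = J ->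
  is_mx_partial d w x (G *m w x) ->
  is_mx_partial d W x (G *m W x + c *: (J *m K x *m W x - W x *m (J *m K x))) ->
  is_mx_partial d (fun y => invmx (w y) *m W y) x
    (c *: (J *m ((w x)^t* *m K x *m w x) *m (invmx (w x) *m W x)
           - invmx (w x) *m W x *m J *m K x)).
Proof.
move=> wu wJw dw dW; have wxu : w x \in unitmx := nbhs_singleton wu.
(* Multiply w^* J w = J by J on the left and by w^-1 J on the right. *)
have wJ : J *m (w x)^t* = invmx (w x) *m J.
  have := congr1 (fun M => J *m M *m invmx (w x) *m J) wJw.
  by rewrite /= !mulmxA mulmxK// JJ mul1mx -!mulmxA JJ mulmx1.
(* The derivative of w^-1 is -w^-1 G, so the two terms with G cancel, and [wJ] puts the rest in the
   form with w^* K w. *)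
apply: is_mx_partial_eq (is_mx_partialM (is_mx_partialV wu dw) dW) _.
rewrite !mulmxA wJ mulmxK// mulmxK//.
rewrite mulmxDr -scalemxAr mulNmx !mulmxA addrA addNr add0r.
by rewrite mulmxBr !mulmxA.
Qed.

End Conservation.

(** * Assembly of the two systems for v *)

Theorem theorem4p1 (R : realType) (m n : nat)
    (D : set (R * R)) (J : 'M[R[i]]_m) (H calH : R * R -> 'M[R[i]]_m)
    (calA : 'M[R[i]]_n) (Pi : R * R -> 'M[R[i]]_(n, m))
    (S : R * R -> 'M[R[i]]_n) (w0 : R * R -> 'M[R[i]]_m)
    (D_open : open D) (D_connected : connected D) (D_0 : D (0, 0))
    (J_unit : J \in unitmx) (J_adj : J = J^t* ) (J_inv : J = invmx J)
    (H_C1 : mx_C1_on D H) (calH_C1 : mx_C1_on D calH)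
    (H_adj : forall x, D x -> H x = (H x)^t* )
    (calH_adj : forall x, D x -> calH x = (calH x)^t* )
    (H_calH : forall x, D x ->
       J *m H x - J *m calH x
         + 'i%C *: mx_comm (J *m H x) (J *m calH x) = 0)
    (H_eta : forall x, D x -> mx_partial deta H x = mx_partial dxi calH x)
    (calA_unit : forall x, D x -> calA - (x.1 + x.2)%:C%C%:M \in unitmx)
    (S_unit : forall x, D x -> S x \in unitmx)
    (S0_adj : S (0, 0) = (S (0, 0))^t* )
    (S0_identity :
       Amx calA (0, 0) *m S (0, 0) - S (0, 0) *m (Amx calA (0, 0))^t*
         = 'i%C *: (Pi (0, 0) *m J *m (Pi (0, 0))^t* ))
    (Pi_xi : forall x, D x ->
       is_mx_partial dxi Pi x (- ('i%C *: (Amx calA x *m Pi x *m J *m H x))))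
    (Pi_eta : forall x, D x ->
       is_mx_partial deta Pi x
         (- ('i%C *: (Amx calA x *m Pi x *m J *m calH x))))
    (S_xi : forall x, D x ->
       is_mx_partial dxi S x
         (Pi x *m J *m H x *m J^t* *m (Pi x)^t*
            - (Amx calA x *m S x + S x *m (Amx calA x)^t* )))
    (S_eta : forall x, D x ->
       is_mx_partial deta S x
         (Pi x *m J *m calH x *m J^t* *m (Pi x)^t*
            - (Amx calA x *m S x + S x *m (Amx calA x)^t* )))
    (w0_xi : forall x, D x -> is_mx_partial dxi w0 x (G0 J Pi S H x *m w0 x))
    (w0_eta : forall x, D x ->
       is_mx_partial deta w0 x (G0 J Pi S calH x *m w0 x))
    (w0_0 : (w0 (0, 0))^t* *m J *m w0 (0, 0) = J) :
  let v := darboux_v J calA Pi S w0 in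
  let tH x := (w0 x)^t* *m H x *m w0 x in
  let tcalH x := (w0 x)^t* *m calH x *m w0 x in
  forall (x : R * R) (z : R[i]),
    D x -> ~~ eigenvalue calA z -> z != (x.1 + x.2)%:C%C ->
    is_mx_partial dxi (v z) x
      (('i%C * (z - (x.1 + x.2)%:C%C)^-1) *:
         (J *m tH x *m v z x - v z x *m J *m H x)) /\
    is_mx_partial deta (v z) x
      (('i%C * (z - (x.1 + x.2)%:C%C)^-1) *:
         (J *m tcalH x *m v z x - v z x *m J *m calH x)).
Proof.
move=> v tH tcalH x z Dx zE zx.
have JJ : J *m J = 1%:M by rewrite {2}J_inv mulmxV.
have nearD y : D y -> \forall u \near y, D u by move=> Dy; exact: open_nbhs_nbhs.
have d1 : (@dxi R).1 + (@dxi R).2 = 1 by rewrite /= addr0.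
have d2 : (@deta R).1 + (@deta R).2 = 1 by rewrite /= add0r.
have dA d y : d.1 + d.2 = 1 -> D y ->
    is_mx_partial d (Amx calA) y (Amx calA y *m Amx calA y).
  by move=> ? /nearD Dy; apply: is_mx_partial_Amx => //; exact: filterS Dy.
have displ y : D y -> Amx calA y *m S y - S y *m (Amx calA y)^t* =
    'i%C *: (Pi y *m J *m (Pi y)^t* ).
  move=> Dy; apply/eqP; rewrite -subr_eq0; apply/eqP.
  pose Q u := Amx calA u *m S u - S u *m (Amx calA u)^t* -
    'i%C *: (Pi u *m J *m (Pi u)^t* ).
  rewrite -/(Q y) (mx_partials0_cst (M := Q) (y := (0, 0)) D_open)//.
    by rewrite /Q S0_identity subrr.
  move=> u Du; split.
  - exact: (is_mx_partial_displacement (K := H) J_adj (H_adj _ Du) (dA _ _ d1 Du)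
      (Pi_xi _ Du) (S_xi _ Du)).
  - exact: (is_mx_partial_displacement (K := calH) J_adj (calH_adj _ Du)
      (dA _ _ d2 Du) (Pi_eta _ Du) (S_eta _ Du)).
have S_adj y : D y -> S y = (S y)^t*.
  move=> Dy.
  pose Q u := Amx calA u *m (S u - (S u)^t* ) *m (Amx calA u)^t*.
  have Q0 : Q y = 0.
    rewrite (mx_partials0_cst (M := Q) (y := (0, 0)) D_open)//.
      by rewrite /Q -S0_adj subrr mulmx0 mul0mx.
    move=> u Du; split.
    - exact: (is_mx_partial_congruence (K := H) J_adj (H_adj _ Du) (dA _ _ d1 Du)
        (S_xi _ Du)).
    - exact: (is_mx_partial_congruence (K := calH) J_adj (calH_adj _ Du)
        (dA _ _ d2 Du) (S_eta _ Du)).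
  have Au : Amx calA y \in unitmx by rewrite unitmx_inv calA_unit.
  have Asu : (Amx calA y)^t* \in unitmx by rewrite map_unitmx unitmx_tr.
  apply/eqP; rewrite -subr_eq0; apply/eqP.
  (* The congruence is undone by the inverses of A and of its adjoint. *)
  have -> : S y - (S y)^t* = invmx (Amx calA y) *m Q y *m invmx ((Amx calA y)^t* ).
    by rewrite /Q !mulmxA mulVmx// mul1mx mulmxK.
  by rewrite Q0 mulmx0 mul0mx.
have w0_J y : D y -> (w0 y)^t* *m J *m w0 y = J.
  move=> Dy; pose Q u := (w0 u)^t* *m J *m w0 u.
  rewrite -/(Q y) (mx_partials0_cst (M := Q) (y := (0, 0)) D_open)//.
  move=> u Du; split.
  - exact: (is_mx_partial_gauge (G0_skew Pi J_adj JJ (H_adj _ Du) (S_adj _ Du))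
      (w0_xi _ Du)).
  - exact: (is_mx_partial_gauge (G0_skew Pi J_adj JJ (calH_adj _ Du) (S_adj _ Du))
      (w0_eta _ Du)).
have w0_unit y : D y -> w0 y \in unitmx.
  (* J is invertible and equals w_0^* J w_0, so its right factor w_0 is invertible. *)
  move=> Dy; have := J_unit; rewrite -{1}(w0_J _ Dy) unitmx_mul.
  by case/andP.
have nS : \forall y \near x, S y \in unitmx by exact: filterS (nearD _ Dx).
have nw : \forall y \near x, w0 y \in unitmx by exact: filterS (nearD _ Dx).
(* Differentiating inverses requires invertibility on a neighbourhood, so z must also avoid xi + eta
   near x. *)
have nA : \forall y \near x, Amx calA y - (z - (y.1 + y.2)%:C%C)^-1%:M \in unitmx.
  near=> y; apply: Amx_sub_unit => //.
  - by apply: calA_unit; near: y; exact: nearD.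
  - by near: y; exact: coord_sum_neq_near.
split.
- apply: (is_mx_partial_gauge_transform (K := H) JJ nw (w0_J _ Dx) (w0_xi _ Dx)).
  exact: (is_mx_partial_wA (K := H) J_adj JJ (H_adj _ Dx) (dA _ _ d1 Dx)
    (Pi_xi _ Dx) (S_xi _ Dx) nS nA (is_cderive_lambda d1 zx) (displ _ Dx)).
- apply: (is_mx_partial_gauge_transform (K := calH) JJ nw (w0_J _ Dx) (w0_eta _ Dx)).
  exact: (is_mx_partial_wA (K := calH) J_adj JJ (calH_adj _ Dx) (dA _ _ d2 Dx)
    (Pi_eta _ Dx) (S_eta _ Dx) nS nA (is_cderive_lambda d2 zx) (displ _ Dx)).
Unshelve. all: by end_near. Qed.
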